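(* For every integer $r\ge 1$, the limit $$\lim_{n\to\infty}\mathbb{E}\left[M_{[0,n-1]}^r\right]$$ exists and is finite.
   Context: For integers $a\le b$, $[a,b]$ denotes the set of integers $x$ with $a\le x\le b$. For a set $X$ of integers, $X+X=\{x+y: x,y\in X\}$. For each $n\ge 1$, let $A$ be chosen uniformly at random among the $2^n$ subsets of $[0,n-1]$, and let $M_{[0,n-1]}:=|[0,2n-2]\setminus(A+A)|$ be the number of missing sums. *)

(* Defs.v *)
From HB Require Import structures.
From mathcomp Require Import all_boot all_order all_algebra.

Set Implicit Arguments.
Unset Strict Implicit.
Unset Printing Implicit Defensive.

Import GRing.Theory.
Local Open Scope ring_scope.

(* For n >= 1, a set A of integers in [0, n-1] is an [A : {set 'I_n}], and
   [0, 2n-2] is the index type ['I_(2 * n - 1)], so no sum x + y is out of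
   range.  The case n = 0 is degenerate, with both index types empty. *)
Definition sumset (n : nat) (A : {set 'I_n}) : {set 'I_(2 * n - 1)} :=
  [set k : 'I_(2 * n - 1) |
    [exists x in A, [exists y in A, (x + y)%N == k :> nat]]].

Definition missing_sums (n : nat) (A : {set 'I_n}) : nat := #|~: sumset A|.

(* The expectation of X(t), for t uniformly distributed on T. *)
Definition uniform_expectation (R : fieldType) (T : finType) (X : T -> R) : R :=
  (\sum_(t : T) X t) / #|T|%:R.

(* Main.v *)
Require Import Defs.
From HB Require Import structures.
From mathcomp Require Import all_boot all_order all_algebra.
From mathcomp Require Import zify ring lra.
From mathcomp Require Import all_classical all_reals all_analysis.
Import Order.TTheory GRing.Theory Num.Theory.
Import numFieldNormedType.Exports.
Set Implicit Arguments.
Unset Strict Implicit.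
Unset Printing Implicit Defensive.
Local Open Scope ring_scope.

(** Write [M] for the number of missing sums of a random subset [A] of
    {0, ..., n-1}.  A sum [k] is rarely missing unless it lies close to [0] or to
    [2n-2], because a sum at distance [m] from the nearer of these two has about
    [m/2] disjoint representations.  So [M] is governed by what [A] looks
    like near the two ends of {0, ..., n-1}, and that has a law that does not
    depend on [n].

    Call the distance of [k] to the nearer end its depth, and fix a cutoff [K].

    - Whether the sums of depth less than [K] are missing depends only on the
      first [K] and the last [K] elements of {0, ..., n-1}.  For [2K <= n] these
      two windows are disjoint, and the trace of a uniform random set on a fixed
      subset is uniform ([mean_preimset]), so the [r]-th moment of the number of
      missing sums of depth less than [K] is a constant [c K]
      ([card_shallow_missing]).

    - A sum of depth [m] is missing with probability at most
      [(3/4) ^ j], with [j] the integer part of [(m+1)/2], since none of [j]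
      disjoint pairs may be contained in [A] ([mean_missing_le]).  If some missing sum has depth
      at least [K], let [m] be the largest depth of a missing sum: all missing
      sums then lie among the at most [2(m+1)] sums of depth at most [m], so
      [M ^ r <= (2(m+1)) ^ r] ([missing_sums_expn_le]).  Summing over [m >= K] a
      polynomial times a geometric sequence, the deep missing sums add at most
      [C rho ^ K] to the [r]-th moment, uniformly in [n]
      ([mean_moment_truncate]).

    Hence the [r]-th moment lies between [c K] and [c K + C rho ^ K]
    for all [n >= 2K].  As [rho < 1], the moments form a Cauchy sequence. *)

(** * Uniform expectations *)

Lemma ler_mean (R : numFieldType) (T : finType) (X Y : T -> R) :
  (forall t, X t <= Y t) -> uniform_expectation X <= uniform_expectation Y.
Proof.
move=> leXY; apply: ler_wpM2r; first by rewrite invr_ge0 ler0n.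
exact: ler_sum.
Qed.

Lemma meanD (R : fieldType) (T : finType) (X Y : T -> R) :
  uniform_expectation (fun t => X t + Y t) =
  uniform_expectation X + uniform_expectation Y.
Proof. by rewrite /uniform_expectation big_split mulrDl. Qed.

Lemma meanZ (R : fieldType) (T : finType) (a : R) (X : T -> R) :
  uniform_expectation (fun t => a * X t) = a * uniform_expectation X.
Proof. by rewrite /uniform_expectation -mulr_sumr mulrA. Qed.

Lemma mean_sum (R : fieldType) (T I : finType) (P : pred I) (X : I -> T -> R) :
  uniform_expectation (fun t => \sum_(i | P i) X i t) =
  \sum_(i | P i) uniform_expectation (X i).
Proof. by rewrite /uniform_expectation exchange_big mulr_suml. Qed.

(** * The trace of a uniform random set *)

Definition symdiff (T : finType) (A B : {set T}) : {set T} :=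
  [set x | (x \in A) (+) (x \in B)]%SET.

Lemma symdiffK (T : finType) (B : {set T}) : involutive (fun A => symdiff A B).
Proof. by move=> A; apply/setP=> x; rewrite !inE addbK. Qed.

Lemma symdiffKl (T : finType) (A : {set T}) : involutive (symdiff A).
Proof. by move=> B; apply/setP=> x; rewrite !inE addKb. Qed.

Lemma card_set_gt0 (R : numDomainType) (T : finType) : 0 < #|{set T}|%:R :> R.
Proof. by rewrite ltr0n; apply/card_gt0P; exists finset.set0. Qed.

Lemma card_set (T : finType) : #|{set T}| = (2 ^ #|T|)%N.
Proof.
rewrite -[in RHS]cardsT -card_powerset -cardsT; congr #|pred_of_set _|.
by apply/setP=> A; rewrite !inE finset.subsetT.
Qed.

(** The trace of a uniform random set on a subset is uniform; the subset is
    given by an injection [u].  Taking the symmetric difference of [A] with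
    [u @: B] permutes the sets [A] and translates the trace by [B]; averaging
    over all [B] replaces the trace by a uniform random set. *)
Lemma mean_preimset (R : numFieldType) (S T : finType) (u : S -> T)
    (G : {set S} -> R) : injective u ->
  uniform_expectation (fun A : {set T} => G (u @^-1: A)%SET) =
  uniform_expectation G.
Proof.
move=> u_inj.
have shift (B : {set S}) : \sum_(A : {set T}) G (symdiff (u @^-1: A)%SET B) =
    \sum_(A : {set T}) G (u @^-1: A)%SET.
  rewrite [RHS](reindex_inj (inv_inj (symdiffK (u @: B)%SET))) /=.
  apply: eq_bigr => A _; congr (G _); apply/setP=> x.
  by rewrite !inE mem_imset.
have count : (\sum_(A : {set T}) G (u @^-1: A)%SET) *+ #|{set S}| =
    (\sum_B G B) *+ #|{set T}|.
  transitivity (\sum_(B : {set S}) \sum_(A : {set T})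
                  G (symdiff (u @^-1: A)%SET B)).
    by rewrite (eq_bigr _ (fun B _ => shift B)) sumr_const.
  rewrite exchange_big /= -sumr_const; apply: eq_bigr => A _.
  by rewrite [RHS](reindex_inj (inv_inj (symdiffKl (u @^-1: A)%SET))).
have nzS := lt0r_neq0 (card_set_gt0 R S).
have nzT := lt0r_neq0 (card_set_gt0 R T).
by apply/eqP; rewrite /uniform_expectation eqr_div // !mulr_natr count.
Qed.

(** For each [i] three of the four traces on the pair [(false, i), (true, i)]
    are admissible, and the [j] choices are independent. *)
Lemma mean_no_pair_le (R : numFieldType) (j : nat) :
  uniform_expectation (fun B : {set bool * 'I_j} =>
    [forall i, ~~ (((false, i) \in B) && ((true, i) \in B))]%:R) <=
  (3 / 4) ^+ j :> R.
Proof.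
rewrite /uniform_expectation card_set card_prod card_bool card_ord expnM.
rewrite expr_div_n natrX ler_wpM2r ?invr_ge0 ?exprn_ge0 ?ler0n//.
rewrite -natr_sum -natrX ler_nat.
rewrite (_ : (\sum_(B : {set bool * 'I_j}) _)%N =
    #|[set B : {set bool * 'I_j} |
       [forall i, ~~ (((false, i) \in B) && ((true, i) \in B))]]%SET|); last first.
  by rewrite -sum1dep_card [RHS]big_mkcond; apply: eq_bigr => B _; case: ifP.
pose code (B : {set bool * 'I_j}) : {ffun 'I_j -> bool * bool} :=
  [ffun i => ((false, i) \in B, (true, i) \in B)].
have code_inj : injective code.
  move=> B C /ffunP eqBC; apply/setP=> -[c i].
  by have := eqBC i; rewrite !ffunE => -[]; case: c.
have -> : 3%N = #|predC1 (true, true)|.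
  by have := cardC1 (true, true); rewrite card_prod card_bool => ->.
rewrite -[j in (_ ^ j)%N]card_ord -card_ffun_on -(card_imset _ code_inj).
apply/subset_leq_card/fintype.subsetP => _ /imsetP[B + ->].
rewrite inE => /forallP noB; apply/ffun_onP => i.
by rewrite ffunE !inE; have := noB i; case: (_ \in B); case: (_ \in B).
Qed.

(** * Sums counted from either end *)

(** The reflection of {0, ..., n-1} maps subsets to subsets and induces the
    reflection of {0, ..., 2n-2} on their sumsets, so statements about the low and
    the high end can be proved together, with [b] naming the end. *)
Definition from_end n (b : bool) (i : 'I_n) : 'I_n :=
  if b then rev_ord i else i.

Lemma from_endK n b : involutive (@from_end n b).
Proof. by case: b => // i; rewrite /from_end rev_ordK. Qed.

Lemma sumset_from_end n b (A : {set 'I_n}) (k : 'I_(2 * n - 1)) :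
  (from_end b k \in sumset A) =
  [exists i : 'I_n, [exists j : 'I_n,
    [&& from_end b i \in A, from_end b j \in A & (i + j)%N == k]]].
Proof.
rewrite inE; apply/existsP/existsP => -[x].
  case/andP=> Ax /existsP[y /andP[Ay xy]].
  exists (from_end b x); apply/existsP; exists (from_end b y).
  rewrite !from_endK Ax Ay /=; move: xy (ltn_ord x) (ltn_ord y) (ltn_ord k).
  by rewrite /from_end; case: b => //= /eqP xy; lia.
case/existsP=> y /and3P[Ax Ay xy].
exists (from_end b x); rewrite Ax; apply/existsP; exists (from_end b y).
rewrite Ay /=; move: xy (ltn_ord x) (ltn_ord y) (ltn_ord k).
by rewrite /from_end; case: b {Ax Ay} => //= /eqP xy; lia.
Qed.

Lemma leq_sum_range n : (n <= 2 * n - 1)%N.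
Proof. lia. Qed.

Definition end_sum n (b : bool) (k : 'I_n) : 'I_(2 * n - 1) :=
  from_end b (widen_ord (leq_sum_range n) k).

Definition depth n (k : 'I_(2 * n - 1)) : nat := minn k (2 * n - 2 - k).

Lemma depth_end_sum n b (k : 'I_n) : depth (end_sum b k) = k.
Proof.
by rewrite /depth /end_sum /from_end; have := ltn_ord k; case: b => /=; lia.
Qed.

(** The middle sum [n-1] has both forms, so [b] is not determined by [k]. *)
Lemma end_sumP n (k : 'I_(2 * n - 1)) :
  exists b (m : 'I_n), k = end_sum b m.
Proof.
have ltk := ltn_ord k.
have [ltkn|lenk] := ltnP k n.
  by exists false, (Ordinal ltkn); apply/val_inj.
have ltm : (2 * n - 2 - k < n)%N by lia.
exists true, (Ordinal ltm); apply/val_inj => /=; lia.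
Qed.

(** * Shallow missing sums have a law independent of n *)

Definition shallow_missing n K (A : {set 'I_n}) : {set 'I_(2 * n - 1)} :=
  [set k in ~: sumset A | (depth k < K)%N]%SET.

Definition window n K (leKn : (K <= n)%N) (p : bool * 'I_K) : 'I_n :=
  from_end p.1 (widen_ord leKn p.2).

Definition window_sum n K (leKn : (K <= n)%N) (p : bool * 'I_K) :
    'I_(2 * n - 1) :=
  end_sum p.1 (widen_ord leKn p.2).

Lemma shallow_missing_imset n K (leKn : (K <= n)%N) (A : {set 'I_n}) :
  shallow_missing K A =
  (window_sum leKn @: [set p | window_sum leKn p \notin sumset A])%SET.
Proof.
apply/setP=> k; apply/idP/imsetP => [|[p + ->]]; last first.
  by rewrite !inE depth_end_sum /= ltn_ord andbT.
have [b [m ->]] := end_sumP k; rewrite !inE depth_end_sum => /andP[miss ltmK].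
have eq_m : m = widen_ord leKn (Ordinal ltmK) by apply/val_inj.
by exists (b, Ordinal ltmK); rewrite ?inE /window_sum /= -eq_m // inE.
Qed.

Lemma card_shallow_missing_le n K (A : {set 'I_n}) : (K <= n)%N ->
  (#|shallow_missing K A| <= 2 * K)%N.
Proof.
move=> leKn; rewrite (shallow_missing_imset leKn).
rewrite (leq_trans (leq_imset_card _ _)) //.
by rewrite (leq_trans (max_card _)) // card_prod card_bool card_ord.
Qed.

Lemma window_inj n K (leKn : (K <= n)%N) :
  (2 * K <= n)%N -> injective (window leKn).
Proof.
move=> le2Kn [b i] [c j] /(congr1 val); rewrite /window /from_end /=.
have := ltn_ord i; have := ltn_ord j; move: le2Kn.
by case: b; case: c => /= ? ? ? ?; try lia;
  congr pair; apply/val_inj => /=; lia.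
Qed.

Lemma window_sum_inj n K (leKn : (K <= n)%N) :
  (2 * K <= n)%N -> injective (window_sum leKn).
Proof.
move=> le2Kn [b i] [c j] /(congr1 val).
rewrite /window_sum /end_sum /from_end /=.
have := ltn_ord i; have := ltn_ord j; move: le2Kn.
by case: b; case: c => /= ? ? ? ?; try lia;
  congr pair; apply/val_inj => /=; lia.
Qed.

(** The shallow missing sums expressed through the trace [B] of the random set
    on the two windows alone, with no reference to [n]. *)
Definition window_missing K (B : {set bool * 'I_K}) : {set bool * 'I_K} :=
  [set p : bool * 'I_K | ~~ [exists i : 'I_K, [exists j : 'I_K,
     [&& (p.1, i) \in B, (p.1, j) \in B & (i + j)%N == p.2]]]]%SET.

(** Two summands of a sum of depth less than [K] are themselves within [K] of
    the same end, so the windows see every representation. *)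
Lemma card_shallow_missing n K (leKn : (K <= n)%N) (A : {set 'I_n}) :
  (2 * K <= n)%N ->
  #|shallow_missing K A| = #|window_missing (window leKn @^-1: A)%SET|.
Proof.
move=> le2Kn; rewrite (shallow_missing_imset leKn).
rewrite (card_imset _ (window_sum_inj _)) //.
apply: eq_card => -[b p].
rewrite [LHS]inE [RHS]inE /window_sum /end_sum sumset_from_end; congr (~~ _).
apply/existsP/existsP => -[i /existsP[j /and3P[Ai Aj /= ijp]]].
  have ltpK := ltn_ord p.
  have ltiK : (i < K)%N by lia.
  have ltjK : (j < K)%N by lia.
  exists (Ordinal ltiK); apply/existsP; exists (Ordinal ltjK).
  rewrite !inE /window /= ijp andbT; apply/andP.
  by split; [move: Ai | move: Aj]; congr (from_end _ _ \in A); apply/val_inj.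
exists (widen_ord leKn i); apply/existsP; exists (widen_ord leKn j).
by move: Ai Aj; rewrite !inE => -> ->.
Qed.

(** * Deep missing sums are rare *)

(** The pairs [{i, k-i}] with [i < (k+1)/2] are disjoint, and none of them may be
    contained in [A]; for even [k] the condition on [k/2] is dropped. *)
Lemma mean_missing_le (R : numFieldType) n b (k : 'I_n) :
  uniform_expectation (fun A : {set 'I_n} =>
    (end_sum b k \notin sumset A)%:R) <= (3 / 4) ^+ k.+1./2 :> R.
Proof.
pose j := k.+1./2; have le2jk : (2 * j <= k.+1)%N by rewrite /j; lia.
have summand_lt (p : bool * 'I_j) : ((if p.1 then k - p.2 else p.2) < n)%N.
  by have := ltn_ord p.2; have := ltn_ord k; case: p.1; lia.
pose u p := from_end b (Ordinal (summand_lt p)).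
have u_inj : injective u.
  move=> [c i] [c' i'] /(inv_inj (@from_endK n b)) /(congr1 val) /=.
  have := ltn_ord i; have := ltn_ord i'; move: le2jk.
  by case: c; case: c' => ? ? ? ?; try lia;
    congr pair; apply/val_inj => /=; lia.
apply: le_trans (mean_no_pair_le R j); rewrite -(mean_preimset _ u_inj).
apply: ler_mean => A; rewrite ler_nat.
have [//|/negP miss] := boolP (end_sum b k \in sumset A).
rewrite lt0b; apply/forallP => i; rewrite !inE; apply/negP => /andP[Ai Aki].
apply: miss; rewrite sumset_from_end.
apply/existsP; exists (Ordinal (summand_lt (false, i))).
apply/existsP; exists (Ordinal (summand_lt (true, i))).
by rewrite Ai Aki /=; have := ltn_ord i; lia.
Qed.

(** When some missing sum has depth at least [K], a single summand on the right
    is enough: the one for the largest depth [m] of a missing sum. *)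
Lemma missing_sums_expn_le n K r (A : {set 'I_n}) :
  (missing_sums A ^ r <= #|shallow_missing K A| ^ r +
     \sum_(m < n | K <= m) (2 * m.+1) ^ r *
       \sum_(b : bool) (end_sum b m \notin sumset A))%N.
Proof.
have [/forallP shallow|] :=
  boolP [forall k in ~: sumset A, depth k < K]%N%SET.
  suff -> : missing_sums A = #|shallow_missing K A| by rewrite leq_addr.
  apply: eq_card => k; rewrite [RHS]inE.
  by apply/idP/andP => [Ak|[]//]; have := shallow k; rewrite Ak.
rewrite negb_forall_in => /exists_inP[k0 miss0]; rewrite -leqNgt => leK0.
have [k /= miss_k max_k] := arg_maxnP (@depth n) miss0.
have [b [m def_k]] := end_sumP k.
have def_m : depth k = m by rewrite def_k depth_end_sum.
have leKm : (K <= m)%N by rewrite -def_m (leq_trans leK0 (max_k _ miss0)).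
rewrite (leq_trans _ (leq_addl _ _))// (bigD1 m)//=.
rewrite (leq_trans _ (leq_addr _ _))// (bigD1 b)//= -def_k.
have -> : k \notin sumset A by rewrite -finset.in_setC.
rewrite mulnDr muln1.
rewrite (leq_trans _ (leq_addr _ _))//.
have bound : (missing_sums A <= 2 * m.+1)%N.
  apply: leq_trans (card_shallow_missing_le A (ltn_ord m)).
  apply/subset_leq_card/fintype.subsetP => k' miss'.
  by rewrite inE miss' ltnS -def_m; apply: max_k.
by case: (r) => // s; rewrite leq_exp2r.
Qed.

(** By induction on [r]: with [s = sqrt t], one factor [m+1] is absorbed by
    [s ^ m], because [(m+1) s ^ m <= 1 + s + ... + s ^ m <= 1 / (1 - s)], and
    [s ^ m] is left for the remaining [r] factors. *)
Lemma expn_geometric_le (R : rcfType) r (t : R) : 0 <= t < 1 ->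
  exists C rho : R, [/\ 0 <= C, 0 <= rho < 1 &
    forall m, m.+1%:R ^+ r * t ^+ m <= C * rho ^+ m].
Proof.
elim: r t => [|r IHr] t /andP[t_ge0 t_lt1].
  by exists 1, t; rewrite t_ge0 t_lt1 ler01; split=> // m; rewrite expr0.
pose s := Num.sqrt t.
have s_ge0 : 0 <= s by apply: sqrtr_ge0.
have s_lt1 : s < 1 by rewrite -sqrtr1 ltr_sqrt.
have linear m : m.+1%:R * s ^+ m <= (1 - s)^-1.
  rewrite -[leRHS]div1r ler_pdivlMr ?subr_gt0//.
  apply: (@le_trans _ _ (1 - s ^+ m.+1)); last by rewrite gerBl exprn_ge0.
  have -> : 1 - s ^+ m.+1 = (\sum_(i < m.+1) s ^+ i) * (1 - s).
    by rewrite -[LHS]opprB subrX1 -mulNr opprB mulrC.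
  apply: ler_wpM2r; first by rewrite subr_ge0 ltW.
  have -> : m.+1%:R * s ^+ m = \sum_(i < m.+1) s ^+ m.
    by rewrite sumr_const card_ord mulr_natl.
  apply: ler_sum => i _.
  by apply: ler_wiXn2l; rewrite ?s_ge0 ?(ltW s_lt1) -1?ltnS ?ltn_ord.
have [//|C [rho [C_ge0 rho01 bound]]] := IHr s; first by rewrite s_ge0.
exists ((1 - s)^-1 * C), rho; split=> // [|m].
  by rewrite mulr_ge0// invr_ge0 subr_ge0 ltW.
have -> : m.+1%:R ^+ r.+1 * t ^+ m =
    (m.+1%:R * s ^+ m) * (m.+1%:R ^+ r * s ^+ m).
  by rewrite -(sqr_sqrtr t_ge0) -/s exprS -exprM mulnC exprM expr2; ring.
rewrite -[leRHS]mulrA; apply: ler_pM => //.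
- by rewrite mulr_ge0 ?exprn_ge0.
- by rewrite mulr_ge0 ?exprn_ge0.
Qed.

Lemma geometric_tail_le (R : realFieldType) (rho : R) K n : 0 <= rho < 1 ->
  \sum_(m < n | (K <= m)%N) rho ^+ m <= rho ^+ K / (1 - rho).
Proof.
move=> /andP[rho_ge0 rho_lt1].
rewrite -(@big_geq_mkord _ _ _ K n xpredT (fun m => rho ^+ m)).
rewrite ler_pdivlMr ?subr_gt0//.
have [leKn|/ltnW leKn] := leqP K n; last first.
  by rewrite big_geq// mul0r exprn_ge0.
rewrite mulr_suml.
rewrite (@telescope_sumr_eq _ K n (fun m => - rho ^+ m))//; last first.
  by move=> m _; rewrite exprS; ring.
by rewrite opprK addrC gerBl exprn_ge0.
Qed.

(** Uniformity of the error in [n] is what makes the moments for different [n]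
    comparable. *)
Lemma mean_moment_truncate (R : realType) r :
  exists C rho : R, [/\ 0 <= C, 0 <= rho < 1 & forall n K,
    uniform_expectation (fun A : {set 'I_n} => (missing_sums A)%:R ^+ r : R) <=
    uniform_expectation (fun A : {set 'I_n} => #|shallow_missing K A|%:R ^+ r) +
    C * rho ^+ K].
Proof.
pose t : R := Num.sqrt (3 / 4).
have t_ge0 : 0 <= t by apply: sqrtr_ge0.
have t_lt1 : t < 1 by rewrite -sqrtr1 ltr_sqrt//; lra.
have t_sqr : t ^+ 2 = 3 / 4 by rewrite sqr_sqrtr//; lra.
have [|C [rho [C_ge0 /andP[rho_ge0 rho_lt1] bound]]] := @expn_geometric_le R r t.
  by rewrite t_ge0.
exists (2 ^+ r.+1 * C / (1 - rho)), rho; split=> [||n K].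
- by rewrite divr_ge0 ?mulr_ge0 ?exprn_ge0 ?ler0n ?subr_ge0 ?(ltW rho_lt1).
- by rewrite rho_ge0.
have pointwise (A : {set 'I_n}) : (missing_sums A)%:R ^+ r <=
    #|shallow_missing K A|%:R ^+ r +
    \sum_(m < n | (K <= m)%N) (2 * m.+1%:R) ^+ r *
       \sum_(b : bool) (end_sum b m \notin sumset A)%:R :> R.
  have := missing_sums_expn_le K r A.
  rewrite -(ler_nat R) natrX natrD natrX natr_sum => /le_trans; apply.
  rewrite lerD2l; apply: ler_sum => m _.
  by rewrite natrM natr_sum natrX natrM.
apply: le_trans (ler_mean pointwise) _; rewrite meanD lerD2l mean_sum.
apply: (@le_trans _ _ (\sum_(m < n | (K <= m)%N) 2 ^+ r.+1 * C * rho ^+ m)).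
  apply: ler_sum => m _; rewrite meanZ mean_sum.
  have tail : \sum_(b : bool) uniform_expectation (fun A : {set 'I_n} =>
      (end_sum b m \notin sumset A)%:R) <= 2 * t ^+ m :> R.
    have -> : 2 * t ^+ m = \sum_(b : bool) t ^+ m.
      by rewrite sumr_const card_bool mulr_natl.
    apply: ler_sum => b _; apply: le_trans (mean_missing_le _ b m) _.
    by rewrite -t_sqr -exprM ler_wiXn2l ?(ltW t_lt1)//; lia.
  apply: le_trans (ler_wpM2l _ tail) _; first by rewrite exprn_ge0.
  rewrite exprMn -mulrA -[leLHS]mulrA.
  have -> : 2 ^+ r * (m.+1%:R ^+ r * (2 * t ^+ m)) =
    2 ^+ r.+1 * (m.+1%:R ^+ r * t ^+ m) by rewrite exprS; ring.
  by rewrite ler_wpM2l ?exprn_ge0.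
rewrite -mulr_sumr -[leRHS]mulrA [_^-1 * _]mulrC ler_wpM2l ?mulr_ge0 ?exprn_ge0//.
by apply: geometric_tail_le; rewrite rho_ge0.
Qed.

(** * Convergence of the moments *)

Local Open Scope classical_set_scope.

Theorem corollary1p4 (R : realType) (r : nat) (hr : (1 <= r)%N) :
  exists l : R,
    (fun n : nat =>
       uniform_expectation (fun A : {set 'I_n} => (missing_sums A)%:R ^+ r : R))
      @ \oo --> l.
Proof.
set moment : nat -> R := fun n => uniform_expectation _.
have [C [rho [C_ge0 /andP[rho_ge0 rho_lt1] bound]]] := @mean_moment_truncate R r.
pose c K := uniform_expectation (fun B : {set bool * 'I_K} =>
  #|window_missing B|%:R ^+ r : R).
have approx n K : (2 * K <= n)%N -> c K <= moment n <= c K + C * rho ^+ K.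
  move=> le2Kn; have leKn : (K <= n)%N by lia.
  have -> : c K =
      uniform_expectation (fun A : {set 'I_n} => #|shallow_missing K A|%:R ^+ r).
    rewrite /c -(mean_preimset _ (window_inj (leKn := leKn) le2Kn)).
    by congr uniform_expectation; apply/funext => A; rewrite card_shallow_missing.
  rewrite bound andbT; apply: ler_mean => A.
  apply: lerXn2r; rewrite ?nnegrE ?ler0n// ler_nat subset_leq_card//.
  by apply/fintype.subsetP => k; rewrite inE => /andP[].
apply/cvg_ex; apply/cauchy_cvgP; apply: cauchy_exP => e e_gt0.
have : C * rho ^+ K @[K --> \oo] --> (0 : R).
  rewrite -[0](mulr0 C); apply: cvgMr; apply: cvg_expr.
  by rewrite ger0_norm.
move=> /cvgr0_norm_lt /(_ e e_gt0)[K _ small].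
exists (c K); exists (2 * K)%N => // n /= le2Kn.
have /andP[lec lem] := approx n K le2Kn.
rewrite /ball /= distrC ger0_norm ?subr_ge0// ltrBlDl (le_lt_trans lem)// ltrD2l.
by apply: le_lt_trans (ler_norm _) (small K _) => /=.
Qed.
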